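(* Let $S$ be a $T_s$-set of sequences in a group $G$, let $H$ be a closed normal subgroup of $(G,\tau_S)$, and let $\pi$ be the natural projection from $G$ onto the quotient group $G/H$. Then $\pi(S)=\{\{\pi(u_n)\}:\{u_n\}\in S\}$ is a $T_s$-set of sequences in $G/H$, and the group $G/H$ with the quotient topology of $(G,\tau_S)$ is topologically isomorphic to $(G/H,\tau_{\pi(S)})$.
   Context: A set $S$ of sequences in a group $G$ is a $T_s$-set of sequences if there is a Hausdorff group topology on $G$ in which all sequences of $S$ converge to the unit $e_G$; then $\tau_S$ denotes the finest Hausdorff group topology on $G$ with this property. *)

(* Defs.v *)
From HB Require Import structures.
From mathcomp Require Import all_boot all_order all_algebra.
From mathcomp Require Import all_classical topology.

Set Implicit Arguments.
Unset Strict Implicit.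
Unset Printing Implicit Defensive.

Local Open Scope classical_set_scope.
Local Open Scope quotient_scope.
Local Open Scope group_scope.

(* The library attaches one canonical topology to a type.  Here several
   topologies on the same group are compared, so a topology is first-class
   data, and [with_topology tau] is the carrier equipped with [tau]. *)
Record topology_on (T : Type) := TopologyOn {
  opens :> set (set T);
  opens_setT : opens setT;
  opens_setI : setI_closed opens;
  opens_bigcup : forall F : set (set T),
    F `<=` opens -> opens (\bigcup_(A in F) A)
}.

Definition with_topology (T : Type) (tau : topology_on T) : Type := T.

Section with_topology_choice.
Context {T : choiceType} (tau : topology_on T).

HB.instance Definition _ := Choice.on (with_topology tau).

Fact with_topology_bigU (I : Type) (f : I -> set (with_topology tau)) :
  (forall i, opens tau (f i)) -> opens tau (\bigcup_i f i).
Proof.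
move=> fo; have -> : \bigcup_i f i = \bigcup_(A in range f) A.
  apply/seteqP; split=> [x [i _ fx]|x [_ [i _ <-] fx]]; last by exists i.
  by exists (f i) => //; exists i.
by apply: opens_bigcup => _ [i _ <-]; exact: fo.
Qed.

HB.instance Definition _ := isOpenTopological.Build (with_topology tau)
  (@opens_setT _ tau) (@opens_setI _ tau) with_topology_bigU.

End with_topology_choice.

HB.instance Definition _ (G : groupType) (tau : topology_on G) :=
  Group.on (with_topology tau).

Lemma open_with_topology (T : choiceType) (tau : topology_on T) :
  @open (with_topology tau) = tau.
Proof. by []. Qed.

Section topology_of.
Variable T : topologicalType.

Fact topology_of_bigcup (F : set (set T)) :
  F `<=` open -> open (\bigcup_(A in F) A).
Proof. by move=> Fo; apply: bigcup_open. Qed.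

Definition topology_of : topology_on T :=
  TopologyOn openT (@openI T) topology_of_bigcup.

End topology_of.

Section group_topologies.
Context {G : groupType}.
Implicit Types (tau sigma : topology_on G) (S : set (nat -> G)).

Definition group_topology tau :=
  continuous (fun x : with_topology tau * with_topology tau => x.1 * x.2) /\
  continuous (fun x : with_topology tau => x^-1).

Definition converge_to_unit tau S :=
  forall u, S u -> (u : nat -> with_topology tau) @ \oo --> (1 : with_topology tau).

Definition Ts_topology S tau :=
  [/\ group_topology tau, hausdorff_space (with_topology tau)
    & converge_to_unit tau S].

Definition Ts_set S := exists tau, Ts_topology S tau.

Definition finest_Ts_topology S tau :=
  Ts_topology S tau /\ forall sigma, Ts_topology S sigma -> sigma `<=` tau.

Lemma finest_Ts_topology_exists S :
  Ts_set S -> exists tau, finest_Ts_topology S tau.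
Proof.
move=> [tau0 hs0].
pose I := {tau | Ts_topology S tau}.
pose Tc (i : I) : Topological G := Topological.class (with_topology (projT1 i)).
pose tau := topology_of (sup_topology Tc).
have tauP (F : set_system G) (x : G) : Filter F ->
    (F --> (x : with_topology tau)) <->
    (forall i : I, F --> (x : with_topology (projT1 i))).
  move=> FF; have -> : nbhs (x : with_topology tau) = nbhs (x : sup_topology Tc).
    by rewrite [LHS]nbhsE [RHS]nbhsE.
  exact: (@cvg_sup G I Tc).
have finer (i : I) (x : G) :
    nbhs (x : with_topology tau) --> (x : with_topology (projT1 i)).
  exact: (tauP _ x (nbhs_filter (x : with_topology tau))).1.
exists tau; split=> [|sigma hsigma A Ao].
  split.
  - split=> x.
      apply: (tauP _ _ (fmap_filter _ (nbhs_filter x))).2 => i.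
      have [[+ _] _ _] := projT2 i => /(_ x).
      apply: cvg_trans; apply: cvg_app.
      by move=> A [[B C] [/finer Bx /finer Cx] BCA]; exists (B, C).
    apply: (tauP _ _ (fmap_filter _ (nbhs_filter x))).2 => i.
    have [[_ +] _ _] := projT2 i => /(_ x).
    by apply: cvg_trans; apply: cvg_app; exact: finer.
  - move=> p q pq; have [_ + _] := hs0; apply => A B pA qB.
    by apply: pq; exact: (finer (exist _ tau0 hs0)).
  - move=> u Su; apply: (tauP _ _ (fmap_filter _ _)).2 => i.
    by have [_ _] := projT2 i; exact.
have : @open (with_topology sigma) A by [].
rewrite openE => Ai.
rewrite -[opens tau]/(@open (with_topology tau)) openE => x Ax.
exact: (finer (exist _ sigma hsigma)) (Ai x Ax).
Qed.

Lemma finest_Ts_topology_unique S tau sigma :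
  finest_Ts_topology S tau -> finest_Ts_topology S sigma ->
  tau = sigma :> set (set G).
Proof.
by move=> [htau tauM] [hsigma sigmaM]; apply/seteqP; split; [exact: sigmaM|exact: tauM].
Qed.

(* [tauS hS] is only formed from a proof that S is a T_s-set; [tauSP] states
   its defining property. *)
Definition tauS S (hS : Ts_set S) : topology_on G :=
  projT1 (cid (finest_Ts_topology_exists hS)).

Lemma tauSP S (hS : Ts_set S) : finest_Ts_topology S (tauS hS).
Proof. exact: projT2 (cid (finest_Ts_topology_exists hS)). Qed.

End group_topologies.

Record normal_subgroup (G : groupType) := NormalSubgroup {
  nsubgroup :> set G;
  nsubgroup1 : nsubgroup 1;
  nsubgroupM : forall x y, nsubgroup x -> nsubgroup y -> nsubgroup (x * y);
  nsubgroupV : forall x, nsubgroup x -> nsubgroup x^-1;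
  nsubgroupJ : forall x y, nsubgroup x -> nsubgroup (x ^ y)
}.

Section quotient_group.
Context {G : groupType} (H : normal_subgroup G).

Definition coset_rel : rel G := fun x y => `[< nsubgroup H (x^-1 * y) >].

Fact coset_rel_refl : reflexive coset_rel.
Proof. by move=> x; apply/asboolP; rewrite mulVg; exact: nsubgroup1. Qed.

Fact coset_rel_sym : symmetric coset_rel.
Proof.
suff imp x y : coset_rel x y -> coset_rel y x.
  by move=> x y; apply/idP/idP; exact: imp.
move=> /asboolP /nsubgroupV Hxy; apply/asboolP.
by move: Hxy; rewrite invgM invgK.
Qed.

Fact coset_rel_trans : transitive coset_rel.
Proof.
move=> y x z /asboolP Hxy /asboolP Hyz; apply/asboolP.
by have := nsubgroupM Hxy Hyz; rewrite mulgA mulgK.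
Qed.

Canonical coset_equiv :=
  EquivRel coset_rel coset_rel_refl coset_rel_sym coset_rel_trans.

Definition quotient_group := {eq_quot coset_equiv}.

HB.instance Definition _ := EqQuotient.on quotient_group.
HB.instance Definition _ := Choice.on quotient_group.

Lemma pi_quotientP x y :
  \pi_quotient_group x = \pi_quotient_group y <-> nsubgroup H (x^-1 * y).
Proof. by split=> [/eqmodP/asboolP//|Hxy]; apply/eqmodP/asboolP. Qed.

Definition quotient_one : quotient_group := \pi_quotient_group 1.
Definition quotient_inv (a : quotient_group) : quotient_group :=
  \pi_quotient_group ((repr a)^-1).
Definition quotient_mul (a b : quotient_group) : quotient_group :=
  \pi_quotient_group (repr a * repr b).

Fact pi_quotient_mul x y :
  \pi_quotient_group (x * y) = quotient_mul (\pi_quotient_group x) (\pi_quotient_group y).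
Proof.
have := reprK (\pi_quotient_group x); have := reprK (\pi_quotient_group y).
rewrite /quotient_mul; move: (repr _) (repr _) => y' x'.
move=> /esym/pi_quotientP Hy /esym/pi_quotientP Hx; apply/pi_quotientP.
have := nsubgroupM (nsubgroupJ y Hx) Hy.
by rewrite invgM conjgE -!mulgA mulVKg.
Qed.

Fact pi_quotient_inv x : \pi_quotient_group x^-1 = quotient_inv (\pi_quotient_group x).
Proof.
have := reprK (\pi_quotient_group x); rewrite /quotient_inv.
move: (repr _) => x' /pi_quotientP Hx; apply/pi_quotientP.
by have := nsubgroupJ x'^-1 Hx; rewrite conjgE !invgK mulgA mulVKg.
Qed.

Fact quotient_mulA : associative quotient_mul.
Proof.
move=> a b c; rewrite -[a]reprK -[b]reprK -[c]reprK; move: (repr a) (repr b) (repr c) => x y z.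
by rewrite -(pi_quotient_mul y z) -(pi_quotient_mul x y) -!pi_quotient_mul mulgA.
Qed.

Fact quotient_mul1 : left_id quotient_one quotient_mul.
Proof. by move=> a; rewrite -[a]reprK; move: (repr a) => x; rewrite -pi_quotient_mul mul1g. Qed.

Fact quotient_1mul : right_id quotient_one quotient_mul.
Proof. by move=> a; rewrite -[a]reprK; move: (repr a) => x; rewrite -pi_quotient_mul mulg1. Qed.

Fact quotient_mulV : left_inverse quotient_one quotient_inv quotient_mul.
Proof. by move=> a; rewrite -[a]reprK; move: (repr a) => x; rewrite -pi_quotient_inv -pi_quotient_mul mulVg. Qed.

Fact quotient_Vmul : right_inverse quotient_one quotient_inv quotient_mul.
Proof. by move=> a; rewrite -[a]reprK; move: (repr a) => x; rewrite -pi_quotient_inv -pi_quotient_mul mulgV. Qed.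

HB.instance Definition _ := isGroup.Build quotient_group
  quotient_mulA quotient_mul1 quotient_1mul quotient_mulV quotient_Vmul.

Definition quotient_topology_on (tau : topology_on G) : topology_on quotient_group :=
  topology_of (@quotient_topology (with_topology tau) quotient_group).

Lemma quotient_topology_onE (tau : topology_on G) (U : set quotient_group) :
  opens (quotient_topology_on tau) U = opens tau (\pi_quotient_group @^-1` U).
Proof. by []. Qed.

End quotient_group.

(* [g] is the inverse of the group isomorphism [f]. *)
Definition topologically_isomorphic (G K : groupType)
    (tau : topology_on G) (sigma : topology_on K) :=
  exists (f : G -> K) (g : K -> G),
    [/\ {morph f : x y / x * y}, cancel f g, cancel g f,
        continuous (f : with_topology tau -> with_topology sigma)
      & continuous (g : with_topology sigma -> with_topology tau)].

(* Main.v *)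
(** Write [tau] for the topology [tauS hS] on [G].  The quotient topology is a
    Hausdorff group topology ([H] is closed) in which the projected sequences
    converge, so the projection of [S] is a T_s-set and the quotient topology
    is coarser than the finest topology [sigma] on [G/H].  Conversely, the join
    of [tau] and of the pullback of [sigma] along the projection is a Hausdorff
    group topology on [G] in which [S] converges to the unit; by maximality it
    is contained in [tau], hence the projection is continuous from [tau] to
    [sigma] and [sigma] is coarser than the quotient topology. *)
Require Import Defs.
From HB Require Import structures.
From mathcomp Require Import all_boot all_order all_algebra.
From mathcomp Require Import all_classical topology.
Set Implicit Arguments.
Unset Strict Implicit.
Unset Printing Implicit Defensive.
Local Open Scope classical_set_scope.
Local Open Scope quotient_scope.
Local Open Scope group_scope.

Lemma continuous_id_with_topology (T : choiceType) (tau sigma : topology_on T) :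
  sigma `<=` tau ->
  continuous (idfun : with_topology tau -> with_topology sigma).
Proof. by move=> sub; apply/continuousP => A; exact: sub. Qed.

Section pullback_join.
Context {G K : groupType} (p : G -> K).
Context (tau : topology_on G) (sigma : topology_on K).

Let graph (x : G) : with_topology tau * with_topology sigma := (x, p x).

(** The initial topology of the graph map into the product is the coarsest one that contains [tau]
    and makes [p] continuous into [sigma]. *)
Definition pullback_join : topology_on G :=
  topology_of (initial_topology graph).

(** This universal property splits each later convergence check into one for [tau] and one for
    [sigma]. *)
Lemma cvg_pullback_join (F : set_system G) (x : G) : Filter F ->
  (F --> (x : with_topology pullback_join)) <->
  (F --> (x : with_topology tau)) /\
  (p @ F --> (p x : with_topology sigma)).
Proof.
move=> FF.
(* [with_topology] rebuilds neighbourhoods from the open sets, so the two filters are compared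
   through [nbhsE]. *)
have -> : nbhs (x : with_topology pullback_join) =
    nbhs (x : initial_topology graph) by rewrite [LHS]nbhsE [RHS]nbhsE.
have -> : (F --> nbhs (x : initial_topology graph)) <->
    (graph @ F --> graph x).
  split=> [Fx|Fx].
    by move=> C /(@initial_continuous _ _ graph x) /Fx.
  move=> A [B [[C Co <-] Cx CA]]; apply: (filterS CA).
  by apply: (Fx C); exact: open_nbhs_nbhs.
split=> [Fx|[Fx pFx]]; last first.
  exact: (@cvg_pair _ _ _ F (nbhs (x : with_topology tau))
    (nbhs (p x : with_topology sigma)) _ _ _ idfun p).
have [x1 x2] : (fst @ nbhs (graph x) --> (x : with_topology tau)) /\
    (snd @ nbhs (graph x) --> (p x : with_topology sigma)).
  by split; [exact: cvg_fst|exact: cvg_snd].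
by split=> A; [move=> /x1 /Fx|move=> /x2 /Fx].
Qed.

Lemma pullback_join_nbhs (x : G) :
  (nbhs (x : with_topology pullback_join) --> (x : with_topology tau)) /\
  (p @ nbhs (x : with_topology pullback_join) -->
    (p x : with_topology sigma)).
Proof. by apply/cvg_pullback_join. Qed.

Lemma group_topology_pullback_join : {morph p : x y / x * y} ->
  group_topology tau -> group_topology sigma ->
  group_topology pullback_join.
Proof.
move=> pM [tauM tauV] [sigmaM sigmaV].
have p1 : p 1 = 1 by apply: (mulgI (p 1)); rewrite -pM !mulg1.
have pV x : p x^-1 = (p x)^-1.
  by apply: (mulgI (p x)); rewrite -pM !mulgV.
split=> x.
- have [x1 px1] := pullback_join_nbhs x.1.
  have [x2 px2] := pullback_join_nbhs x.2.
  apply/(cvg_pullback_join _ (fmap_filter _ (nbhs_filter x))).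
  split.
    by move=> A /(tauM x) [[B C] [/x1 Bx /x2 Cx] BCA]; exists (B, C).
  rewrite /= pM => A /(sigmaM (p x.1, p x.2)) [[B C] [/px1 Bx /px2 Cx] BCA].
  exists (p @^-1` B, p @^-1` C) => // -[y z] [/= By Cz].
  by rewrite pM; exact: (BCA (p y, p z)).
- have [x1 px1] := pullback_join_nbhs x.
  apply/(cvg_pullback_join _ (fmap_filter _ (nbhs_filter x))).
  split; first by move=> A /(tauV x) /x1.
  rewrite pV => A /(sigmaV (p x)) /px1 xA.
  by apply: (filterS (F := nbhs (x : with_topology pullback_join)) _ xA) => y /=;
    rewrite pV.
Qed.

(** The join refines [tau], so [tau]-neighbourhoods already separate points. *)
Lemma hausdorff_pullback_join : hausdorff_space (with_topology tau) ->
  hausdorff_space (with_topology pullback_join).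
Proof.
move=> tauH x y xy; apply: tauH => A B xA yB.
by apply: xy; exact: (pullback_join_nbhs _).1.
Qed.

Lemma pullback_join_preimage (A : set K) : opens sigma A ->
  opens pullback_join (p @^-1` A).
Proof.
move=> Ao; exists (snd @^-1` A) => //.
by apply: (@open_comp (with_topology tau * with_topology sigma)%type
  (with_topology sigma)) => // x _; exact: cvg_snd.
Qed.

End pullback_join.

Section quotient_topology_on.
Context {G : groupType} (H : normal_subgroup G) (tau : topology_on G).
Local Notation Q := (quotient_group H).
Local Notation q := (quotient_topology_on H tau).
Hypothesis tauG : group_topology tau.

Lemma pi_quotient_continuous :
  continuous (\pi_Q : with_topology tau -> with_topology q).
Proof. by apply/continuousP. Qed.

Lemma mulg_right_continuous (h : G) :
  continuous ((fun x => x * h) : with_topology tau -> with_topology tau).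
Proof.
move=> x A /(tauG.1 (x, h)) [[B C] [/= Bx Ch] BCA].
apply: (filterS (F := nbhs (x : with_topology tau)) _ Bx) => y By.
by apply: (BCA (y, h)); split => //; exact: nbhs_singleton Ch.
Qed.

(** The saturation of [A] is the union of its translates by elements of [H], each open because right
    translations are continuous. *)
Lemma pi_quotient_open (A : set G) :
  opens tau A -> opens q (\pi_Q @` A).
Proof.
move=> Ao; rewrite quotient_topology_onE.
have -> : \pi_Q @^-1` (\pi_Q @` A) =
    \bigcup_(B in [set (fun x => x * h) @^-1` A | h in H]) B.
  apply/seteqP; split=> [x [a Aa /esym/pi_quotientP Hax]|x [_ [h Hh <-] Axh]].
    exists ((fun y => y * (x^-1 * a)) @^-1` A); last by rewrite /= mulVKg.
    by exists (x^-1 * a).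
  by exists (x * h) => //; apply/esym/pi_quotientP; rewrite mulKg.
apply: opens_bigcup => _ [h _ <-].
by move/continuousP : (@mulg_right_continuous h); exact.
Qed.

Lemma pi_quotient_nbhs (x : G) (A : set G) :
  nbhs (x : with_topology tau) A ->
  nbhs (\pi_Q x : with_topology q) (\pi_Q @` A).
Proof.
rewrite nbhsE => -[B [Bo Bx] BA]; rewrite nbhsE; exists (\pi_Q @` B).
  by split; [exact: pi_quotient_open|exists x].
exact: image_subset.
Qed.

(** Continuity is checked on representatives in [G]; since the projection is open, the
    neighbourhoods found there can be pushed down to the quotient. *)
Lemma group_topology_quotient : group_topology q.
Proof.
split.
  move=> [a b] A; rewrite -[a]reprK -[b]reprK /=.
  move: (repr a) (repr b) => x y.
  (* The group law is unfolded to [quotient_mul] so that the product of two classes becomes the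
     class of a product. *)
  rewrite -[_ * _]/(quotient_mul _ _) -pi_quotient_mul.
  move=> /pi_quotient_continuous /(tauG.1 (x, y)) [[B C] [/= Bx Cy] BCA].
  exists (\pi_Q @` B, \pi_Q @` C); first by split; exact: pi_quotient_nbhs.
  move=> [_ _] [/= [u Bu <-] [v Cv <-]].
  rewrite -[_ * _]/(quotient_mul _ _) -pi_quotient_mul.
  exact: (BCA (u, v)).
move=> a A; rewrite -[a]reprK; move: (repr a) => x.
rewrite -[_^-1]/(quotient_inv _) -pi_quotient_inv.
move=> /pi_quotient_continuous /(tauG.2 x) /pi_quotient_nbhs.
apply: filterS => _ [u Au <-] /=.
by rewrite -[_^-1]/(quotient_inv _) -pi_quotient_inv.
Qed.

(** If [x] and [y] lie in different cosets, [x^-1 * y] is in the open complement of [H]. By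
    continuity so is [u^-1 * v] for [u] near [x] and [v] near [y], so the images of these
    neighbourhoods are disjoint. *)
Lemma hausdorff_quotient : closed (H : set (with_topology tau)) ->
  hausdorff_space (with_topology q).
Proof.
move=> Hcl a b; rewrite -[a]reprK -[b]reprK.
move: (repr a) (repr b) => x y xy; apply/pi_quotientP; apply: contrapT => nHxy.
have HC : nbhs (x^-1 * y : with_topology tau) (~` H).
  by apply: open_nbhs_nbhs; split => //; exact: closed_openC.
have [[B C] [/= /(tauG.2 x) /pi_quotient_nbhs Bx /pi_quotient_nbhs Cy] BCH] :=
  tauG.1 (x^-1, y) _ HC.
have [_ [[u Bu <-] [v Cv /esym/pi_quotientP Huv]]] := xy _ _ Bx Cy.
exact: (BCH (u^-1, v)).
Qed.

End quotient_topology_on.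

Theorem theorem1p12 (G : groupType) (S : set (nat -> G)) (hS : Ts_set S)
    (H : normal_subgroup G)
    (Hclosed : closed (H : set (with_topology (tauS hS)))) :
  exists hpiS : Ts_set [set \pi_(quotient_group H) \o u | u in S],
    topologically_isomorphic (quotient_topology_on H (tauS hS)) (tauS hpiS).
Proof.
have [[tauG tauH tauC] tauM] := tauSP hS.
have piM : {morph \pi_(quotient_group H) : x y / x * y}.
  exact: pi_quotient_mul.
have hq : Ts_topology [set \pi_(quotient_group H) \o u | u in S]
    (quotient_topology_on H (tauS hS)).
  split; [exact: group_topology_quotient|exact: hausdorff_quotient|].
  move=> _ [u Su <-].
  exact: (cvg_comp _ _ (tauC u Su) (@pi_quotient_continuous _ H _ 1)).
have hpiS : Ts_set [set \pi_(quotient_group H) \o u | u in S].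
  by exists (quotient_topology_on H (tauS hS)).
exists hpiS; have [[sigmaG _ sigmaC] sigmaM] := tauSP hpiS.
(* Both topologies live on the same group, so the identity is the isomorphism and its continuity
   each way amounts to an inclusion of topologies. *)
exists idfun, idfun; split=> //; apply: continuous_id_with_topology.
  move=> A Ao; rewrite quotient_topology_onE.
  apply: (tauM (pullback_join \pi_(quotient_group H) (tauS hS) (tauS hpiS)));
    last exact: pullback_join_preimage.
  split; [exact: group_topology_pullback_join|exact: hausdorff_pullback_join|].
  move=> u Su; apply/cvg_pullback_join; split; first exact: tauC.
  by apply: sigmaC; exists u.
exact: sigmaM.
Qed.
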